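(* Let $\mathscr{K}$ be a class of finite structures of some relational signature, closed under taking isomorphic copies of (induced) substructures, such that for all $n\in\mathbb{N}$ there exists a finite structure $\mathbb{S}_n$ of this signature with the following properties: \begin{itemize} \item $\mathbb{S}_n\notin\mathscr{K}$; \item the disjoint union of any finite number of copies of $n$-balls in $\mathbb{S}_n$ lies in $\mathscr{K}$. \end{itemize} Then $\mathscr{K}$ cannot be defined amongst finite structures by any first order sentence; that is, there is no first order sentence $\varphi$ of the signature such that, for every finite structure $\mathbb{A}$ of the signature, $\mathbb{A}\models\varphi$ if and only if $\mathbb{A}\in\mathscr{K}$.
   Context: For a relational structure $\mathbb{A}$ with underlying set $A$, let $\overline{\mathbb{A}}$ be the graph on $A$ with an undirected edge between $a$ and $b$ whenever $a$ and $b$ appear together in a tuple of one of the relations of $\mathbb{A}$. The distance $d_{\mathbb{A}}(a,b)$ is the length of a shortest path of edges between $a$ and $b$ in $\overline{\mathbb{A}}$, with $d_{\mathbb{A}}(a,a)=0$ and $d_{\mathbb{A}}(a,b)=\infty$ if there is no path. The $n$-ball of $a$ in $\mathbb{A}$ is the set $B_n(a)=\{x\in A\mid d_{\mathbb{A}}(x,a)\le n\}$, and also the induced substructure $\mathbb{B}_n(a)$ of $\mathbb{A}$ on this set. The $n$-balls in $\mathbb{S}_n$ are the structures $\mathbb{B}_n(a)$ for $a$ an element of $\mathbb{S}_n$; in a disjoint union of copies of $n$-balls, different copies may be copies of different $n$-balls, and the same $n$-ball may be used repeatedly. *)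

(* Defs.v *)
From mathcomp Require Import all_boot boolp.

Set Implicit Arguments.
Unset Strict Implicit.
Unset Printing Implicit Defensive.

(* A relational signature; there may be infinitely many relation symbols, and
   any arity (including 0) is allowed. *)
Record signature := Signature { symbol : Type; arity : symbol -> nat }.

(* As usual in first order logic, the universe of a structure is nonempty. *)
Record fin_struct (sg : signature) := FinStruct {
  carrier :> finType;
  interp : forall r : symbol sg, pred ((arity r).-tuple carrier);
  carrier_gt0 : 0 < #|carrier| }.

Arguments interp {sg} _ r _.

Definition isomorphic (sg : signature) (A B : fin_struct sg) : Prop :=
  exists2 f : A -> B, bijective f &
    forall (r : symbol sg) (t : (arity r).-tuple A),
      interp B r (map_tuple f t) = interp A r t.

Section Induced.
Variables (sg : signature) (A : fin_struct sg) (U : {set A}).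
Hypothesis U_neq0 : U != set0.

Lemma induced_gt0 : 0 < #|{: {x : A | x \in U}}|.
Proof. by rewrite card_sig card_gt0. Qed.

Definition induced : fin_struct sg :=
  @FinStruct sg {x : A | x \in U} (fun r t => interp A r (map_tuple val t))
    induced_gt0.
End Induced.

Section Union.
Variables (sg : signature) (k : nat) (B : 'I_k.+1 -> fin_struct sg).

Lemma disjoint_union_gt0 : 0 < #|{: {i : 'I_k.+1 & B i}}|.
Proof.
have /card_gt0P[x _] := carrier_gt0 (B ord0).
by apply/card_gt0P; exists (Tagged (fun i => B i) x).
Qed.

(* As universes are nonempty, only unions of k + 1 >= 1 structures exist. *)
Definition disjoint_union : fin_struct sg :=
  @FinStruct sg {i : 'I_k.+1 & B i}
    (fun r t => [exists i, exists u : (arity r).-tuple (B i),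
       interp (B i) r u && (t == map_tuple (Tagged (fun i => B i)) u)])
    disjoint_union_gt0.
End Union.

Section Gaifman.
Variables (sg : signature) (A : fin_struct sg).

(* The loops that this relation may have do not affect distances. *)
Definition adjacent : rel A := fun a b =>
  `[< exists (r : symbol sg) (t : (arity r).-tuple A),
        [/\ interp A r t, a \in t & b \in t] >].

Definition walk (a b : A) (n : nat) : bool :=
  [exists p : n.-tuple A, path adjacent a p && (last a p == b)].

(* [None] stands for infinite distance. *)
Definition dist (a b : A) : option nat :=
  if pselect (exists n, walk a b n) is left h then Some (ex_minn h) else None.

Definition ball (n : nat) (a : A) : {set A} :=
  [set x | if dist x a is Some d then d <= n else false].

Lemma ball_neq0 (n : nat) (a : A) : ball n a != set0.
Proof.
apply/set0Pn; exists a; rewrite inE /dist.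
have w0 : walk a a 0 by apply/existsP; exists [tuple]; rewrite /= eqxx.
case: pselect => [h|]; last by case; exists 0.
by case: ex_minnP => m _ /(_ _ w0) /leq_trans -> .
Qed.

Definition ball_struct (n : nat) (a : A) : fin_struct sg :=
  induced (ball_neq0 n a).
End Gaifman.

(* First order formulas with equality, with free variables among n de Bruijn
   indices; the variable bound by [Forall] is the index 0. *)
Inductive formula (sg : signature) (n : nat) : Type :=
| Bot
| Equal (i j : 'I_n)
| Rel (r : symbol sg) (t : (arity r).-tuple 'I_n)
| Imp (phi psi : formula sg n)
| Forall (phi : formula sg n.+1).

Definition sentence (sg : signature) := formula sg 0.

Fixpoint sat (sg : signature) (A : fin_struct sg) (n : nat)
    (phi : formula sg n) : n.-tuple A -> bool :=
  match phi with
  | Bot => fun _ => false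
  | Equal i j => fun e => tnth e i == tnth e j
  | Rel r t => fun e => interp A r (map_tuple (tnth e) t)
  | Imp phi psi => fun e => sat phi e ==> sat psi e
  | Forall phi => fun e => [forall x : A, sat phi [tuple of x :: e]]
  end.

Definition models (sg : signature) (A : fin_struct sg) (phi : sentence sg) :
  bool := sat phi ([tuple] : 0.-tuple A).

Definition closed_under_induced (sg : signature) (K : fin_struct sg -> Prop) :
    Prop :=
  forall (A : fin_struct sg) (U : {set A}) (U_neq0 : U != set0)
         (B : fin_struct sg),
    K A -> isomorphic (induced U_neq0) B -> K B.

(* Main.v *)
Require Import Defs.
From mathcomp Require Import all_boot boolp.

Set Implicit Arguments.
Unset Strict Implicit.
Unset Printing Implicit Defensive.

(** Suppose that a sentence [phi] of quantifier rank [q] defines the class.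
    Take [n = 2 ^ q], let [S] be the structure given for [n], let [L] be the
    disjoint union of [q + 1] copies of every [n]-ball of [S], and let [R] be
    the disjoint union of [S] and [L].  Then [L] is in the class, and [R] is
    not, because [S] is an induced substructure of [R].  Both answers come from
    [phi], so it suffices that [L] and [R] satisfy the same sentences of
    quantifier rank [q]; this is a form of Hanf's locality theorem, proved by
    an Ehrenfeucht-Fraisse argument ([sat_similar]).

    Both structures are disjoint unions of substructures of the single
    structure [S], so each element has a component and an underlying element of
    [S] (its [base]).  Duplicator always answers with an element of the same
    base.  Hence no isomorphism between neighbourhoods has to be carried along:
    a position is described by comparing subsets of [S], and all distances are
    measured in [S].  With [k] rounds to go, put [r = 2 ^ k]; the position
    ([similar]) is good if paired elements have components that agree within
    distance [r] of their common base, and if elements with bases at distance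
    at most [r] lie in a common component on one side exactly when they do on
    the other.  Passing from [2 * r] to [r] ([similar_extend]), a new element
    that is close to an old one in its component is answered in the component
    of the partner of the old one, and any other new element is answered in a
    component not yet visited that looks the same around the new base
    ([abundant]).  The latter exists: a ball is copied often enough, and around
    an element [z] of the component [S] the ball of radius [n] centred at [z]
    looks like [S]. *)

(** * The metric of the Gaifman graph *)

Section Metric.
Variables (sg : signature) (A : fin_struct sg).
Implicit Types a b c : A.

Lemma adjacent_sym : symmetric (@adjacent sg A).
Proof.
by move=> a b; apply/asboolP/asboolP => -[r [t [Ht Ha Hb]]]; exists r, t.
Qed.

Lemma walkP a b n :
  reflect (exists p : seq A,
             [/\ path (@adjacent sg A) a p, last a p = b & size p = n])
          (walk a b n).
Proof.
apply: (iffP existsP) => [[p /andP[Hp /eqP Hl]]|[p [Hp Hl Hs]]].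
  by exists p; rewrite size_tuple.
by exists (tcast Hs (in_tuple p)); rewrite val_tcast Hp Hl /=.
Qed.

Lemma walk_sym a b n : walk a b n -> walk b a n.
Proof.
case/walkP => p [Hp <- <-]; apply/walkP; exists (rev (belast a p)).
rewrite size_rev size_belast rev_path; split=> //.
  by rewrite (eq_path (e' := @adjacent sg A)) // => x y; rewrite adjacent_sym.
by case: p {Hp} => //= x p; rewrite rev_cons last_rcons.
Qed.

Lemma walk_cat a b c m n : walk a b m -> walk b c n -> walk a c (m + n).
Proof.
move=> /walkP[p [Hp <- <-]] /walkP[p' [Hp' <- <-]]; apply/walkP.
by exists (p ++ p'); rewrite cat_path Hp Hp' last_cat size_cat.
Qed.

Lemma in_ball n a x :
  reflect (exists2 m, m <= n & walk x a m) (x \in ball n a).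
Proof.
rewrite inE /dist; case: pselect => [h|h].
  case: ex_minnP => d Wd mind.
  by apply: (iffP idP) => [le_dn|[m le_mn /mind/leq_trans->]]; first exists d.
by apply: (iffP idP) => // -[m _ Wm]; case: h; exists m.
Qed.

Lemma ball_center n a : a \in ball n a.
Proof. by apply/in_ball; exists 0 => //; apply/walkP; exists [::]. Qed.

Lemma ball_sym n a b : (a \in ball n b) = (b \in ball n a).
Proof.
by apply/in_ball/in_ball => -[m le_mn /walk_sym W]; exists m.
Qed.

Lemma ball_trans m n a b c :
  a \in ball m b -> b \in ball n c -> a \in ball (m + n) c.
Proof.
move=> /in_ball[i le_im Wi] /in_ball[j le_jn Wj]; apply/in_ball.
by exists (i + j); [apply: leq_add | apply: walk_cat Wj].
Qed.

Lemma sub_ball m n a : m <= n -> ball m a \subset ball n a.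
Proof.
move=> le_mn; apply/subsetP => x /in_ball[d le_dm Wd]; apply/in_ball.
by exists d => //; apply: leq_trans le_mn.
Qed.

Lemma interp_ball n (r : symbol sg) (t : (arity r).-tuple A) a b :
  0 < n -> interp A r t -> a \in t -> b \in t -> a \in ball n b.
Proof.
move=> n_gt0 Ht Ha Hb; apply/in_ball; exists 1 => //; apply/walkP.
by exists [:: b]; split=> //=; rewrite andbT; apply/asboolP; exists r, t.
Qed.

End Metric.

(** * Disjoint unions of substructures of one structure *)

Section Pieces.
Variables (sg : signature) (S : fin_struct sg) (k : nat).
Variables (U : 'I_k.+1 -> {set S}) (U0 : forall i, U i != set0).

Definition pieces : fin_struct sg := disjoint_union (fun i => induced (U0 i)).

Definition component (x : pieces) : 'I_k.+1 := tag x.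
Definition base (x : pieces) : S := val (tagged x).

Definition piece_elt i (z : S) (zU : z \in U i) : pieces :=
  Tagged (fun i => induced (U0 i)) (exist (fun z => z \in U i) z zU).

Lemma base_in (x : pieces) : base x \in U (component x).
Proof. exact: valP (tagged x). Qed.

Lemma pieces_inj (x y : pieces) :
  component x = component y -> base x = base y -> x = y.
Proof.
case: x y => [i x] [j y]; rewrite /component /base /= => Eij.
by case: j / Eij y => y /val_inj ->.
Qed.

Lemma interp_pieces (r : symbol sg) (t : (arity r).-tuple pieces) :
  interp pieces r t =
    interp S r (map_tuple base t) && constant (map component t).
Proof.
apply/existsP/andP => [[i /existsP[u /andP[Hu /eqP ->]]]|[Ht Hc]].
  split.
    have {}Hu : interp S r (map_tuple val u) := Hu.
    apply: etrans Hu; congr (interp S r _).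
    by apply: val_inj; rewrite /= -map_comp.
  rewrite /= -map_comp /=; apply: (@all_pred1_constant _ i).
  by apply/allP => _ /mapP[x _ ->] /=.
(* An empty tuple determines no component; [ord0] then serves. *)
have [i Hi] : exists i, all (fun x => component x == i) t.
  case: (tval t) Hc => [|x s] /=; first by exists ord0.
  move=> Hs; exists (component x); rewrite eqxx /=.
  by rewrite all_map in Hs.
exists i; apply/existsP.
have Hn j : component (tnth t j) = i.
  by apply/eqP; apply: (allP Hi); apply: mem_tnth.
have HU j : base (tnth t j) \in U i by rewrite -(Hn j) base_in.
pose u : (arity r).-tuple (induced (U0 i)) :=
  [tuple (exist (fun z => z \in U i) _ (HU j)) | j < arity r].
exists u; apply/andP; split.
  rewrite -[interp _ r u]/(interp S r (map_tuple val u)).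
  apply: etrans Ht; congr (interp S r _); apply: eq_from_tnth => j.
  by rewrite !tnth_map tnth_ord_tuple.
apply/eqP; apply: eq_from_tnth => j; rewrite !tnth_map tnth_ord_tuple.
by apply: pieces_inj; first exact: Hn.
Qed.

(** A component that is all of [S] is an induced copy of [S]. *)
Lemma closed_pieces (K : fin_struct sg -> Prop) i :
  closed_under_induced K -> U i = setT -> K pieces -> K S.
Proof.
move=> Kc UT KP.
have zU (z : S) : z \in U i by rewrite UT inE.
pose W : {set pieces} := [set x | component x == i].
have zW z : piece_elt (zU z) \in W by rewrite inE.
have W0 (x : {x | x \in W}) : component (val x) = i.
  by apply/eqP; have := valP x; rewrite inE.
have W_neq0 : W != set0.
  by have /card_gt0P[z _] := carrier_gt0 S; apply/set0Pn; exists (piece_elt (zU z)).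
apply: (Kc pieces W W_neq0) => //.
exists (fun x : induced W_neq0 => base (val x)).
  exists (fun z => exist (fun x => x \in W) _ (zW z)) => [x|z] //.
  by apply: val_inj; apply: pieces_inj; rewrite //= (W0 x).
move=> r t; rewrite -[RHS]/(interp pieces r (map_tuple val t)) interp_pieces.
have -> : constant (map component (map_tuple val t)).
  apply: (@all_pred1_constant _ i).
  by apply/allP => _ /mapP[_ /mapP[x _ ->] ->] /=; rewrite (W0 x).
by rewrite andbT; congr (interp S r _); apply: val_inj; rewrite /= -map_comp.
Qed.

End Pieces.

(** * The Ehrenfeucht-Fraisse argument *)

Fixpoint quantifier_rank (sg : signature) n (phi : formula sg n) : nat :=
  match phi with
  | Bot | Equal _ _ | Rel _ _ => 0
  | Imp phi psi => maxn (quantifier_rank phi) (quantifier_rank psi)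
  | Forall phi => (quantifier_rank phi).+1
  end.

Section Locality.
Variables (sg : signature) (S : fin_struct sg).

(** Duplicator's supply of answers: [s] lists the components visited so far,
    and a far move in a component of [U] has to be answered outside of [s]. *)
Definition abundant k k' (U : 'I_k.+1 -> {set S}) (V : 'I_k'.+1 -> {set S})
    (q r : nat) : Prop :=
  forall i (z : S) (s : seq 'I_k'.+1), size s <= q ->
    exists2 j, j \notin s & U i :&: ball r z = V j :&: ball r z.

Section Similar.
Variables (k k' : nat) (U : 'I_k.+1 -> {set S}) (V : 'I_k'.+1 -> {set S}).
Variables (U0 : forall i, U i != set0) (V0 : forall i, V i != set0).

Record similar m (r : nat) (e : m.-tuple (pieces U0))
    (f : m.-tuple (pieces V0)) : Prop := Similar {
  similar_base : forall i, base (tnth e i) = base (tnth f i);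
  similar_local : forall i,
    U (component (tnth e i)) :&: ball r (base (tnth e i)) =
    V (component (tnth f i)) :&: ball r (base (tnth e i));
  similar_component : forall i j,
    base (tnth e i) \in ball r (base (tnth e j)) ->
    (component (tnth e i) == component (tnth e j)) =
    (component (tnth f i) == component (tnth f j)) }.

(** Around a base [z] within [r] of an old base [b], everything within [r] of
    [z] is within [2 * r] of [b], so the hypothesis at radius [2 * r] decides
    it.  This is why the radius doubles with each round. *)
Lemma similar_extend m r (e : m.-tuple (pieces U0)) (f : m.-tuple (pieces V0))
    (x : pieces U0) :
  abundant U V m r -> similar (r + r) e f ->
  exists y : pieces V0, similar r [tuple of x :: e] [tuple of y :: f].
Proof.
move=> abUV [eqb loc cmp].
have mono (z : S) : ball r z \subset ball (r + r) z by apply/sub_ball/leq_addr.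
suff [j HU Hc] : exists2 j,
    U (component x) :&: ball r (base x) = V j :&: ball r (base x) &
    forall i, base x \in ball r (base (tnth e i)) ->
      (component x == component (tnth e i)) = (j == component (tnth f i)).
  have xV : base x \in V j.
    have : base x \in U (component x) :&: ball r (base x).
      by rewrite inE base_in ball_center.
    by rewrite HU => /setIP[].
  exists (piece_elt V0 xV); split=> [i|i|i i'].
  - by case: (unliftP ord0 i) => [h ->|->]; rewrite ?tnthS ?tnth0.
  - case: (unliftP ord0 i) => [h ->|->]; rewrite ?tnthS ?tnth0 //.
    by rewrite -(setIidPr (mono _)) !setIA loc.
  - case: (unliftP ord0 i) => [h ->|->]; case: (unliftP ord0 i') => [h' ->|->];
      rewrite ?tnthS ?tnth0 ?eqxx //.
    + by move=> /(subsetP (mono _))/cmp.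
    + by rewrite ball_sym => /Hc; rewrite ![_ == component (tnth _ _)]eq_sym.
    + by move=> /Hc.
(* [h] is an old element close to [x] in the component of [x], if any. *)
have [h /andP[/eqP xh near]|far] :=
  pickP (fun h => (component x == component (tnth e h)) &&
                  (base x \in ball r (base (tnth e h)))).
  exists (component (tnth f h)).
    apply/setP => w; have /setP/(_ w) := loc h; rewrite !in_setI xh.
    have [wx|] := boolP (w \in ball r (base x)); last by rewrite !andbF.
    by rewrite (ball_trans wx near) !andbT.
  move=> i xi; rewrite xh; apply: cmp.
  by apply: ball_trans xi; rewrite ball_sym.
have [|j jN Hj] := abUV (component x) (base x) (map (@component _ _ _ _ V0) f).
  by rewrite size_map size_tuple.
exists j => // i xi; have := far i; rewrite xi andbT => ->.
by apply/esym/negbTE; apply: contraNneq jN => ->; rewrite map_f ?mem_tnth.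
Qed.

Lemma similar_Rel m (s : symbol sg) (t : (arity s).-tuple 'I_m) r e f :
  0 < r -> similar r e f ->
  interp (pieces U0) s (map_tuple (tnth e) t) =
  interp (pieces V0) s (map_tuple (tnth f) t).
Proof.
move=> r_gt0 [eqb _ cmp]; rewrite !interp_pieces.
have -> : map_tuple (@base _ _ _ _ V0) (map_tuple (tnth f) t) =
          map_tuple (@base _ _ _ _ U0) (map_tuple (tnth e) t).
  by apply: eq_from_tnth => i; rewrite !tnth_map eqb.
have [Ht|//] := boolP (interp S s _); rewrite /=.
(* Entries of a related tuple are adjacent, so their bases are close. *)
have {}cmp i j : i \in tval t -> j \in tval t ->
    (component (tnth e i) == component (tnth e j)) =
    (component (tnth f i) == component (tnth f j)).
  move=> it jt; apply: cmp; apply: interp_ball Ht _ _ => //;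
    by rewrite /= !map_f.
case: (tval t) cmp => //= i l cmp; rewrite !all_map; apply: eq_in_all => j jl /=.
by rewrite cmp // in_cons ?jl ?eqxx ?orbT.
Qed.

End Similar.

Lemma similar_sym k k' (U : 'I_k.+1 -> {set S}) (V : 'I_k'.+1 -> {set S})
    (U0 : forall i, U i != set0) (V0 : forall i, V i != set0) m r
    (e : m.-tuple (pieces U0)) (f : m.-tuple (pieces V0)) :
  similar r e f -> similar r f e.
Proof.
case=> eqb loc cmp; split=> [i|i|i j]; first by rewrite eqb.
  by rewrite -eqb loc.
by rewrite -!eqb => /cmp.
Qed.

Section Sat.
Variables (k k' : nat) (U : 'I_k.+1 -> {set S}) (V : 'I_k'.+1 -> {set S}).
Variables (U0 : forall i, U i != set0) (V0 : forall i, V i != set0).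
Variable q : nat.
Hypothesis abUV : forall m r, m <= q -> r <= 2 ^ q -> abundant U V m r.
Hypothesis abVU : forall m r, m <= q -> r <= 2 ^ q -> abundant V U m r.

(** The pairs already chosen and the quantifiers still to come number at most
    [q] together, so [q] bounds the components visited when [similar_extend]
    needs a new one. *)
Lemma sat_similar m (phi : formula sg m) d (e : m.-tuple (pieces U0))
    (f : m.-tuple (pieces V0)) :
  quantifier_rank phi <= d -> m + d <= q -> similar (2 ^ d) e f ->
  sat phi e = sat phi f.
Proof.
elim: phi d e f => {m} [m|m i j|m s t|m phi IHphi psi IHpsi|m phi IHphi] d e f //=.
- move=> _ _ [eqb _ cmp].
  (* Elements with the same base are equal when they share a component, and
     such bases are at distance 0. *)
  have [Eb|Nb] := eqVneq (base (tnth e i)) (base (tnth e j)); last first.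
    apply/eqP/eqP => E; first by rewrite E eqxx in Nb.
    by rewrite !eqb E eqxx in Nb.
  have := cmp i j; rewrite Eb ball_center => /(_ isT) Ec.
  apply/eqP/eqP => E; apply: pieces_inj => //.
  + by apply/eqP; rewrite -Ec E.
  + by rewrite -!eqb.
  + by apply/eqP; rewrite Ec E.
- by move=> _ _; apply: similar_Rel; rewrite expn_gt0.
- rewrite geq_max => /andP[le1 le2] le_q sim.
  by rewrite (IHphi d e f) // (IHpsi d e f).
- case: d => // d le_d le_q; rewrite expnS mul2n -addnn => sim.
  rewrite addnS -addSn in le_q.
  have le_m : m <= q by apply: leq_trans le_q; rewrite addSn -addnS leq_addr.
  have le_r : 2 ^ d <= 2 ^ q by rewrite leq_exp2l // (leq_trans _ le_q) ?leq_addl.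
  apply/forallP/forallP => all_sat x.
    have [y /similar_sym sim'] := similar_extend x (abVU le_m le_r) (similar_sym sim).
    by rewrite -(IHphi d _ _ _ _ sim').
  have [y sim'] := similar_extend x (abUV le_m le_r) sim.
  by rewrite (IHphi d _ _ _ _ sim').
Qed.

Lemma models_abundant (phi : sentence sg) :
  quantifier_rank phi <= q -> models (pieces U0) phi = models (pieces V0) phi.
Proof.
by move=> le_q; apply: (@sat_similar 0 phi q) => //; split=> -[].
Qed.

End Sat.

End Locality.

(** * Many balls, with and without the whole structure *)

(** Components are indexed by an initial segment of the integers, so the
    [q + 1] copies of each element come from an enumeration of pairs. *)
Lemma repeated_enum (T : finType) (q : nat) : 0 < #|T| ->
  exists k, exists a : 'I_k.+1 -> T, forall (c : T) (s : seq 'I_k.+1),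
    size s <= q -> exists2 i, i \notin s & a i = c.
Proof.
move=> T_gt0.
have [k E] : exists k, #|{: 'I_q.+1 * T}| = k.+1.
  by exists #|{: 'I_q.+1 * T}|.-1; rewrite prednK // card_prod card_ord muln_gt0.
exists k, (fun i => (enum_val (cast_ord (esym E) i)).2) => c s le_sq.
pose h (j : 'I_q.+1) := cast_ord E (enum_rank (j, c)).
have h_inj : injective h by move=> j j' /cast_ord_inj/enum_rank_inj[].
have [j jN|all_s] := pickP (fun j => h j \notin s).
  by exists (h j); rewrite // cast_ordK enum_rankK.
have : size (map h (enum 'I_q.+1)) <= size s.
  apply: uniq_leq_size => [|_ /mapP[j _ ->]]; last exact: negbFE (all_s j).
  by rewrite (map_inj_uniq h_inj) enum_uniq.
by rewrite size_map size_enum_ord leqNgt ltnS le_sq.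
Qed.

Definition add_whole (T : finType) k (U : 'I_k.+1 -> {set T}) (i : 'I_k.+2) :
  {set T} := if unlift ord0 i is Some j then U j else setT.

Lemma add_whole_neq0 (T : finType) k (U : 'I_k.+1 -> {set T}) :
  (forall i, U i != set0) -> forall i, add_whole U i != set0.
Proof.
move=> U0 i; rewrite /add_whole; case: unliftP => [j _|_]; first exact: U0.
by have /set0Pn[z _] := U0 ord0; apply/set0Pn; exists z.
Qed.

Theorem theorem15 (sg : signature) (K : fin_struct sg -> Prop)
  (K_closed : closed_under_induced K)
  (K_local : forall n : nat, exists S : fin_struct sg,
     ~ K S /\
     forall (k : nat) (a : 'I_k.+1 -> S),
       K (disjoint_union (fun i => ball_struct n (a i)))) :
  ~ (exists phi : sentence sg,
       forall A : fin_struct sg, models A phi <-> K A).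
Proof.
case=> phi defK; pose q := quantifier_rank phi.
have [S [KNS KB]] := K_local (2 ^ q).
have [k [a fresh]] := repeated_enum q (carrier_gt0 S).
pose U i := ball (2 ^ q) (a i).
pose U0 i : U i != set0 := ball_neq0 (2 ^ q) (a i).
pose V0 := add_whole_neq0 U0.
have abUV m r : m <= q -> r <= 2 ^ q -> abundant U (add_whole U) m r.
  move=> le_mq _ i z s le_sm.
  have [|j jN Ej] := fresh (a i) (pmap (unlift ord0) s).
    by rewrite size_pmap (leq_trans (count_size _ _)) ?(leq_trans le_sm).
  exists (lift ord0 j); last by rewrite /add_whole liftK /U Ej.
  by apply: contra jN => js; rewrite mem_pmap -(liftK ord0 j) map_f.
have abVU m r : m <= q -> r <= 2 ^ q -> abundant (add_whole U) U m r.
  move=> le_mq le_r i z s le_sm; have le_sq := leq_trans le_sm le_mq.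
  rewrite /add_whole; case: (unliftP ord0 i) => [j _|_].
    by have [j' j'N Ej] := fresh (a j) s le_sq; exists j'; rewrite // /U Ej.
  have [j jN Ej] := fresh z s le_sq; exists j => //.
  by rewrite setTI /U Ej; apply/esym/setIidPr/sub_ball.
have KU : K (pieces U0) := KB k a.
apply: KNS; apply: (closed_pieces (U0 := V0) (i := ord0)) => //.
  by rewrite /add_whole unlift_none.
by apply/defK; rewrite -(models_abundant U0 V0 abUV abVU) //; apply/defK.
Qed.
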